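(* Consider the problem $$\min_{x_1,\dots,x_n}\ \sum_{i=1}^n f_i(x_i)\quad\text{s.t.}\quad \sum_{i=1}^n \mathcal{A}_i(x_i)=b .$$ If $\{\beta_k\}$ is non-decreasing and upper bounded and $\eta_i>n\|\mathcal{A}_i\|^2$ for $i=1,\dots,n$, then the sequence $\{(x_1^k,\dots,x_n^k,\lambda^k)\}_{k\ge 0}$ generated by LADMPSAP (from any initial point $(x_1^0,\dots,x_n^0,\lambda^0)$) converges to a KKT point of the problem.
   Context: Problem data: $f_i:\mathbb{R}^{d_i}\to\mathbb{R}\cup\{+\infty\}$ are closed proper convex functions, $\mathcal{A}_i:\mathbb{R}^{d_i}\to\mathbb{R}^m$ are linear mappings with adjoints $\mathcal{A}_i^\dagger$ and operator norms $\|\mathcal{A}_i\|$, and $b\in\mathbb{R}^m$; $\|\cdot\|$ on vectors (or matrices) is the Euclidean (Frobenius) norm. Standing assumptions: no $\mathcal{A}_i$ is the zero mapping; the solution of $\sum_i\mathcal{A}_i(x_i)=b$ is non-unique; the mapping $(x_1,\dots,x_n)\mapsto\sum_i\mathcal{A}_i(x_i)$ is onto $\mathbb{R}^m$; the problem has a KKT point. KKT point: $(x_1^*,\dots,x_n^*,\lambda^* )$ with $\sum_i\mathcal{A}_i(x_i^* )=b$ and $-\mathcal{A}_i^\dagger(\lambda^* )\in\partial f_i(x_i^* )$ for all $i$, where $\partial f_i$ is the convex subdifferential. LADMPSAP, with parameters $\eta_i>0$ and penalty parameters $\beta_k>0$, run without stopping: given $(x_1^k,\dots,x_n^k,\lambda^k)$,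 set $$\hat\lambda^k=\lambda^k+\beta_k\Big(\sum_{i=1}^n\mathcal{A}_i(x_i^k)-b\Big),$$ $$x_i^{k+1}=\operatorname*{argmin}_{x_i}\ f_i(x_i)+\frac{\eta_i\beta_k}{2}\Big\|x_i-x_i^k+\frac{\mathcal{A}_i^\dagger(\hat\lambda^k)}{\eta_i\beta_k}\Big\|^2,\quad i=1,\dots,n,$$ $$\lambda^{k+1}=\lambda^k+\beta_k\Big(\sum_{i=1}^n\mathcal{A}_i(x_i^{k+1})-b\Big).$$ The positive penalty sequence $\{\beta_k\}$ enters the result only through the hypotheses stated on it. *)

(* Defs.v *)
From HB Require Import structures.
From mathcomp Require Import all_boot all_order all_algebra.
From mathcomp Require Import all_classical all_reals all_analysis.

Set Implicit Arguments.
Unset Strict Implicit.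
Unset Printing Implicit Defensive.

Import Order.TTheory GRing.Theory Num.Theory.
Import numFieldNormedType.Exports.

Local Open Scope classical_set_scope.
Local Open Scope ring_scope.

(* The canonical norm on 'cV[R]_p in the library is the max norm, so the
   Euclidean structure is introduced separately.  Both norms induce the
   library's (product) topology on 'cV[R]_p. *)
Definition dot (R : realType) (p : nat) (u v : 'cV[R]_p) : R :=
  \sum_(j < p) u j 0 * v j 0.

Definition enorm (R : realType) (p : nat) (u : 'cV[R]_p) : R :=
  Num.sqrt (dot u u).

(* The j-th coordinate of the adjoint at v is <A e_j, v>; see adjointP. *)
Definition adjoint (R : realType) (p q : nat)
    (A : {linear 'cV[R]_p -> 'cV[R]_q}) (v : 'cV[R]_q) : 'cV[R]_p :=
  \col_(j < p) dot (A (delta_mx j 0)) v.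

Lemma adjointP (R : realType) (p q : nat) (A : {linear 'cV[R]_p -> 'cV[R]_q})
    (u : 'cV[R]_p) (v : 'cV[R]_q) : dot (A u) v = dot u (adjoint A v).
Proof.
have {1}-> : u = \sum_(j < p) u j 0 *: delta_mx j 0.
  apply/colP => i; rewrite summxE (bigD1 i) //= big1 => [|j ji].
    by rewrite !mxE !eqxx mulr1 addr0.
  by rewrite !mxE eq_sym (negbTE ji) mulr0.
rewrite linear_sum /dot.
under eq_bigr do rewrite summxE mulr_suml.
rewrite exchange_big /=; apply: eq_bigr => j _.
rewrite !mxE /dot mulr_sumr; apply: eq_bigr => i _.
by rewrite linearZ /= mxE mulrA.
Qed.

Definition opnorm (R : realType) (p q : nat)
    (A : {linear 'cV[R]_p -> 'cV[R]_q}) : R :=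
  sup [set enorm (A u) | u in [set u | enorm u <= 1]].

Definition proper_fun (R : realType) (p : nat) (f : 'cV[R]_p -> \bar R) : Prop :=
  (forall u, f u != -oo%E) /\ (exists u, f u != +oo%E).

(* Meant for functions that do not take the value -oo. *)
Definition convex_fun (R : realType) (p : nat) (f : 'cV[R]_p -> \bar R) : Prop :=
  forall (u v : 'cV[R]_p) (t : R), 0 < t -> t < 1 ->
    (f (t *: u + (1 - t) *: v)%R <= t%:E * f u + (1 - t)%:E * f v)%E.

(* For a proper convex function, closedness is lower semicontinuity. *)
Definition closed_proper_convex (R : realType) (p : nat)
    (f : 'cV[R]_p -> \bar R) : Prop :=
  [/\ lower_semicontinuous f, proper_fun f & convex_fun f].

(* Empty at u when f u = +oo and f is proper. *)
Definition subdifferential (R : realType) (p : nat) (f : 'cV[R]_p -> \bar R)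
    (u : 'cV[R]_p) : set 'cV[R]_p :=
  [set g | forall v, (f u + (dot g (v - u))%:E <= f v)%E].

Definition argmin (R : realType) (p : nat) (F : 'cV[R]_p -> \bar R) :
    set 'cV[R]_p :=
  [set u | forall v, (F u <= F v)%E].

Definition lin_comb (R : realType) (n m : nat) (d : 'I_n -> nat)
    (A : forall i, {linear 'cV[R]_(d i) -> 'cV[R]_m})
    (x : forall i, 'cV[R]_(d i)) : 'cV[R]_m :=
  \sum_(i < n) A i (x i).

Definition KKT_point (R : realType) (n m : nat) (d : 'I_n -> nat)
    (f : forall i, 'cV[R]_(d i) -> \bar R)
    (A : forall i, {linear 'cV[R]_(d i) -> 'cV[R]_m}) (b : 'cV[R]_m)
    (x : forall i, 'cV[R]_(d i)) (lam : 'cV[R]_m) : Prop :=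
  lin_comb A x = b /\
  forall i, subdifferential (f i) (x i) (- adjoint (A i) lam).

Definition lam_hat (R : realType) (n m : nat) (d : 'I_n -> nat)
    (A : forall i, {linear 'cV[R]_(d i) -> 'cV[R]_m}) (b : 'cV[R]_m)
    (beta : R) (x : forall i, 'cV[R]_(d i)) (lam : 'cV[R]_m) : 'cV[R]_m :=
  lam + beta *: (lin_comb A x - b).

(* (x k, lam k) is a run of the algorithm; its initial point (x 0, lam 0) is
   unconstrained. *)
Definition LADMPSAP (R : realType) (n m : nat) (d : 'I_n -> nat)
    (f : forall i, 'cV[R]_(d i) -> \bar R)
    (A : forall i, {linear 'cV[R]_(d i) -> 'cV[R]_m}) (b : 'cV[R]_m)
    (eta : 'I_n -> R) (beta : nat -> R)
    (x : nat -> forall i, 'cV[R]_(d i)) (lam : nat -> 'cV[R]_m) : Prop :=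
  forall k,
    (forall i, argmin
       (fun u : 'cV[R]_(d i) =>
          f i u +
          (eta i * beta k / 2 *
             enorm (u - x k i + (eta i * beta k)^-1 *:
                      adjoint (A i) (lam_hat A b (beta k) (x k) (lam k)))
             ^+ 2)%:E)%E
       (x k.+1 i)) /\
    lam k.+1 = lam k + beta k *: (lin_comb A (x k.+1) - b).

(* Main.v *)
Require Import Defs.
From HB Require Import structures.
From mathcomp Require Import all_boot all_order all_algebra.
From mathcomp Require Import all_classical all_reals all_analysis.
From mathcomp Require Import ring lra.
Import Order.TTheory GRing.Theory Num.Theory.
Import numFieldNormedType.Exports.
Local Open Scope classical_set_scope.
Local Open Scope ring_scope.

(** Why the iterates converge. Let (y, mu) be a KKT point and measure the
    distance from the k-th iterate to it by the energy
      W k = sum_i eta_i |x_i^k - y_i|^2 + beta_k^-2 |lambda^k - mu|^2.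
    The minimality of x_i^(k+1) says that
      - eta_i beta_k (x_i^(k+1) - x_i^k) - A_i^T lambda_hat^k
    is a subgradient of f_i at x_i^(k+1) ([prox_subgradient]). Pairing it with
    the subgradient - A_i^T mu at y_i, monotonicity of the subdifferential gives
    one inequality per block; summed over i, they give
      W (k+1) <= W k - sum_i eta_i |x_i^(k+1) - x_i^k|^2 - |r|^2 + 2 <r, q>,
    where r = sum_i A_i x_i^(k+1) - b and q = sum_i A_i (x_i^(k+1) - x_i^k).
    The cross term appears because all blocks are updated in parallel with the
    old multiplier estimate. As |q|^2 <= n sum_i |A_i|^2 |x_i^(k+1) - x_i^k|^2,
    the condition eta_i > n |A_i|^2 makes the quadratic form in
    (x^(k+1) - x^k, r) definite ([lin_combB_le], [energy_decrease]). Replacing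
    beta_k by beta_(k+1) >= beta_k can only lower the energy.

    Hence W is nonincreasing for every KKT point, and the steps and residuals
    tend to 0. As the penalties are bounded above, W controls the multipliers
    too, so the iterates are bounded and converge along some ultrafilter finer
    than the neighbourhoods of infinity. Subdifferentials having closed graphs
    ([subdifferential_closed]), the limit is itself a KKT point ([limit_KKT]).
    The energy relative to that limit is nonincreasing and tends to 0 along the
    ultrafilter, hence along the integers ([run_cvg]). *)

Set Implicit Arguments.
Unset Strict Implicit.
Unset Printing Implicit Defensive.

(** * Euclidean geometry of column vectors *)

Section Dot.
Context {R : realType} {p : nat}.
Implicit Types (u v w : 'cV[R]_p) (a : R).

Lemma dotC u v : dot u v = dot v u.
Proof. by apply: eq_bigr => j _; rewrite mulrC. Qed.

Lemma dotDl u v w : dot (u + v) w = dot u w + dot v w.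
Proof.
by rewrite /dot -big_split; apply: eq_bigr => j _; rewrite mxE mulrDl.
Qed.

Lemma dotZl a u v : dot (a *: u) v = a * dot u v.
Proof. by rewrite /dot mulr_sumr; apply: eq_bigr => j _; rewrite mxE mulrA. Qed.

Lemma dot0l u : dot 0 u = 0.
Proof. by rewrite -(scale0r (0 : 'cV[R]_p)) dotZl mul0r. Qed.

Lemma dotNl u v : dot (- u) v = - dot u v.
Proof. by rewrite -scaleN1r dotZl mulN1r. Qed.

Lemma dotBl u v w : dot (u - v) w = dot u w - dot v w.
Proof. by rewrite dotDl dotNl. Qed.

Lemma dotDr u v w : dot u (v + w) = dot u v + dot u w.
Proof. by rewrite dotC dotDl !(dotC u). Qed.

Lemma dotZr a u v : dot u (a *: v) = a * dot u v.
Proof. by rewrite dotC dotZl dotC. Qed.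

Lemma dotNr u v : dot u (- v) = - dot u v.
Proof. by rewrite dotC dotNl dotC. Qed.

Lemma dotBr u v w : dot u (v - w) = dot u v - dot u w.
Proof. by rewrite dotDr dotNr. Qed.

Lemma dot_suml (I : finType) (F : I -> 'cV[R]_p) v :
  dot (\sum_i F i) v = \sum_i dot (F i) v.
Proof.
rewrite /dot exchange_big; apply: eq_bigr => j _.
by rewrite summxE mulr_suml.
Qed.

Lemma dot_ge0 u : 0 <= dot u u.
Proof. by apply: sumr_ge0 => j _; rewrite -expr2 sqr_ge0. Qed.

Lemma enorm_sqr u : enorm u ^+ 2 = dot u u.
Proof. by rewrite sqr_sqrtr ?dot_ge0. Qed.

Lemma sqr_coord_le_dot u j : u j 0 ^+ 2 <= dot u u.
Proof.
rewrite /dot (bigD1 j) //= expr2 lerDl.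
by apply: sumr_ge0 => i _; rewrite -expr2 sqr_ge0.
Qed.

End Dot.

Definition dotE := (@dotDl, @dotNl, @dotZl, @dotDr, @dotNr, @dotZr).

(** Lagrange's identity in disguise: the difference of the two sides is half
    the sum of the squares [(a i * c j - a j * c i) ^+ 2]. *)
Lemma cauchy_schwarz_sum {R : realType} {I : finType} (a c : I -> R) :
  (\sum_i a i * c i) ^+ 2 <= (\sum_i a i ^+ 2) * (\sum_i c i ^+ 2).
Proof.
set X := \sum_i a i ^+ 2; set Y := \sum_i c i ^+ 2; set Z := \sum_i _.
have : 0 <= \sum_i \sum_j (a i * c j - a j * c i) ^+ 2.
  by apply: sumr_ge0 => i _; apply: sumr_ge0 => j _; exact: sqr_ge0.
have -> : \sum_i \sum_j (a i * c j - a j * c i) ^+ 2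
    = (X * Y + Y * X) - (Z * Z + Z * Z).
  rewrite !big_distrlr /= -!big_split -sumrB; apply: eq_bigr => i _.
  rewrite -!big_split -sumrB; apply: eq_bigr => j _ /=; ring.
lra.
Qed.

(** Cauchy-Schwarz against the constant family [1], one coordinate at a time. *)
Lemma dot_sum_le {R : realType} {p : nat} {I : finType} (y : I -> 'cV[R]_p) :
  dot (\sum_i y i) (\sum_i y i) <= #|I|%:R * \sum_i dot (y i) (y i).
Proof.
rewrite /dot exchange_big /= mulr_sumr; apply: ler_sum => j _.
have := cauchy_schwarz_sum (fun=> 1) (fun i => y i j 0).
under [X in X ^+ 2 <= _ -> _]eq_bigr do rewrite mul1r.
under [in X in _ <= X * _ -> _]eq_bigr do rewrite expr1n.
by rewrite sumr_const -summxE -expr2.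
Qed.

(** Expanding [u] on the canonical basis and applying Cauchy-Schwarz in each
    coordinate bounds [A] by its Frobenius norm; this is what makes the
    supremum defining [opnorm] finite. *)
Lemma linear_bounded {R : realType} {p q : nat}
    (A : {linear 'cV[R]_p -> 'cV[R]_q}) :
  exists2 C : R, 0 <= C & forall u, dot (A u) (A u) <= C * dot u u.
Proof.
pose e j : 'cV[R]_p := delta_mx j 0.
exists (\sum_(i < q) \sum_(j < p) A (e j) i 0 ^+ 2) => [|u].
  by apply: sumr_ge0 => i _; apply: sumr_ge0 => j _; exact: sqr_ge0.
rewrite {1}/dot mulr_suml; apply: ler_sum => i _.
have -> : A u i 0 = \sum_j A (e j) i 0 * u j 0.
  have {1}-> : u = \sum_(j < p) u j 0 *: e j.
    apply/colP => k; rewrite summxE (bigD1 k) //= big1 => [|j jk].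
      by rewrite !mxE !eqxx mulr1 addr0.
    by rewrite !mxE eq_sym (negbTE jk) mulr0.
  rewrite linear_sum summxE; apply: eq_bigr => j _.
  by rewrite linearZ mxE mulrC.
rewrite -expr2; apply: le_trans (cauchy_schwarz_sum _ _) _.
by under [X in _ * X <= _]eq_bigr do rewrite expr2.
Qed.

Lemma le_opnorm {R : realType} {p q : nat}
    (A : {linear 'cV[R]_p -> 'cV[R]_q}) u :
  dot (A u) (A u) <= opnorm A ^+ 2 * dot u u.
Proof.
have [C C0 AC] := linear_bounded A.
have [u0|u0] := eqVneq (dot u u) 0.
  by rewrite u0 mulr0; have := AC u; rewrite u0 mulr0.
have {u0} u_gt0 : 0 < dot u u by rewrite lt_def u0 dot_ge0.
have nu : 0 < enorm u by rewrite sqrtr_gt0.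
pose w := (enorm u)^-1 *: u.
have w1 : dot w w = 1.
  by rewrite !dotE mulrA -invfM -expr2 enorm_sqr mulVf // gt_eqF.
(* [w] is the unit vector along [u]. *)
have Aw : enorm (A w) <= opnorm A.
  apply: ub_le_sup; last first.
    by exists w => //=; rewrite /enorm w1 sqrtr1.
  exists (Num.sqrt C) => _ [v /= v1 <-].
  rewrite /enorm ler_sqrt //; apply: le_trans (AC v) _.
  rewrite -{2}(mulr1 C) ler_wpM2l // -enorm_sqr.
  by rewrite expr_le1 // sqrtr_ge0.
have uE : u = enorm u *: w by rewrite scalerA mulfV ?scale1r // gt_eqF.
clearbody w; rewrite uE; move: (enorm u) => c.
rewrite linearZ !dotE w1 mulr1 mulrA -!expr2 mulrC ler_wpM2r ?sqr_ge0 //.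
by rewrite -enorm_sqr lerXn2r ?nnegrE ?sqrtr_ge0 // (le_trans _ Aw) ?sqrtr_ge0.
Qed.

(** * Limits of column vectors *)

Section ColumnLimits.
Context {R : realType} {T : Type} {F : set_system T} {FF : Filter F}.

Lemma cvg_coordP {p : nat} (u : T -> 'cV[R]_p) (l : 'cV[R]_p) :
  u k @[k --> F] --> l <-> forall j, u k j 0 @[k --> F] --> l j 0.
Proof.
split=> [ul j|ul].
  exact: (cvg_comp _ _ ul (@coord_continuous _ _ _ j 0 l)).
apply/cvg_ballP => e e0; rewrite near_simpl.
have : \forall k \near F, forall j, ball (l j 0) e (u k j 0).
  by apply: filter_forall => j; have /cvg_ballP := ul j; exact.
by apply: filterS => k uk; split=> // i j; rewrite (ord1 j).
Qed.

Lemma cvg_dot {p : nat} (u v : T -> 'cV[R]_p) (a b : 'cV[R]_p) :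
  u k @[k --> F] --> a -> v k @[k --> F] --> b ->
  dot (u k) (v k) @[k --> F] --> dot a b.
Proof.
move=> /cvg_coordP ua /cvg_coordP vb.
by apply: cvg_big => [|j _]; [exact: add_continuous|exact: cvgM].
Qed.

(** The topology on columns comes from the max norm, which the Euclidean norm
    dominates. *)
Lemma cvg_of_dot {p : nat} (u : T -> 'cV[R]_p) (l : 'cV[R]_p) :
  dot (u k - l) (u k - l) @[k --> F] --> (0 : R) -> u k @[k --> F] --> l.
Proof.
move=> ul; apply/cvg_coordP => j; apply/cvgrPdist_lt => e e0.
have e2 : 0 < e ^+ 2 by rewrite exprn_gt0.
apply: filterS (cvgr_lt _ ul _ e2) => k /= uk.
rewrite -(ltr_pXn2r (n := 2)) ?nnegrE ?(ltW e0) // distrC.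
rewrite real_normK ?num_real //.
by apply: le_lt_trans uk; have := sqr_coord_le_dot (u k - l) j; rewrite !mxE.
Qed.

Lemma cvg_linear {p q : nat} (A : {linear 'cV[R]_p -> 'cV[R]_q})
    (u : T -> 'cV[R]_p) (l : 'cV[R]_p) :
  u k @[k --> F] --> l -> A (u k) @[k --> F] --> A l.
Proof.
move=> ul; apply: cvg_of_dot; have [C C0 AC] := linear_bounded A.
have dl : C * dot (u k - l) (u k - l) @[k --> F] --> (0 : R).
  have ul0 : u k - l @[k --> F] --> (0 : 'cV[R]_p).
    by rewrite -(subrr l); apply: cvgB => //; exact: cvg_cst.
  have := cvg_dot ul0 ul0; rewrite dot0l => d0.
  by rewrite -(mulr0 C); apply: cvgMr.
apply: squeeze_cvgr (cvg_cst 0) dl; apply: nearW => k.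
by rewrite dot_ge0 -linearB AC.
Qed.

Lemma cvg_adjoint {p q : nat} (A : {linear 'cV[R]_p -> 'cV[R]_q})
    (v : T -> 'cV[R]_q) (l : 'cV[R]_q) :
  v k @[k --> F] --> l -> adjoint A (v k) @[k --> F] --> adjoint A l.
Proof.
move=> vl; apply/cvg_coordP => j; rewrite mxE.
under eq_fun do rewrite mxE.
by apply: cvg_dot => //; exact: cvg_cst.
Qed.

End ColumnLimits.

(** An ultrafilter plays the part of a convergent subsequence: it settles at
    once the limits of all the blocks, with no diagonal extraction. *)
Lemma compact_ultra_cvg {T : Type} {S : topologicalType} {G : set_system T}
    {GU : UltraFilter G} (K : set S) (h : T -> S) :
  compact K -> (forall k, K (h k)) -> exists l : S, h k @[k --> G] --> l.
Proof.
move=> /(_ (h @ G)) cK Kh.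
have [|l [_ hl]] := cK _; first exact: (filterS (fun k _ => Kh k) filterT).
exists l => N Nl; have [//|GN] := in_ultra_setVsetC (h @^-1` N) GU.
by have [y []] := hl (~` N) N GN Nl.
Qed.

Lemma bounded_ultra_cvg {R : realType} {T : Type} {G : set_system T}
    {GU : UltraFilter G} {p : nat} (u : T -> 'cV[R]_p) (a : 'cV[R]_p) (C : R) :
  (forall k, dot (u k - a) (u k - a) <= C) ->
  exists l : 'cV[R]_p, u k @[k --> G] --> l.
Proof.
move=> uC.
have uj j : exists l : R, u k j 0 @[k --> G] --> l.
  (* [1 + C] bounds the coordinates because [|t| <= 1 + t ^+ 2]. *)
  pose B := 1 + C.
  apply: (compact_ultra_cvg (K := `[a j 0 - B, a j 0 + B])).
    exact: segment_compact.
  move=> k /=; have := le_trans (sqr_coord_le_dot (u k - a) j) (uC k).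
  rewrite !mxE in_itv /= /B; set y := u k j 0; set z := a j 0 => yz.
  have := sqr_ge0 (y - z - 1); have := sqr_ge0 (y - z + 1).
  have := sqr_ge0 (y - z); move: yz; rewrite !expr2 => *.
  by apply/andP; split; lra.
exists (\col_j projT1 (cid (uj j))); apply/cvg_coordP => j.
by rewrite mxE; case: cid.
Qed.

(** * Subgradients *)

Section Subgradient.
Context {R : realType} {p : nat} {f : 'cV[R]_p -> \bar R}.
Hypothesis f_proper : proper_fun f.

Lemma proper_fin u (s : R) : (f u <= s%:E)%E -> exists r, f u = r%:E.
Proof.
have [f_noo _] := f_proper; have := f_noo u.
by case: (f u) => [r _ _||] //; exists r.
Qed.

Lemma proper_exists_fin : exists u (r : R), f u = r%:E.
Proof.
have [f_noo [u]] := f_proper; have := f_noo u; case fu: (f u) => [r||] // _ _.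
by exists u, r.
Qed.

Lemma subdifferential_fin u g : subdifferential f u g -> exists r, f u = r%:E.
Proof.
have [v [s fv]] := proper_exists_fin => /(_ v); rewrite fv => fuv.
apply: (@proper_fin _ (s - dot g (v - u))).
by rewrite EFinB leeBrDr.
Qed.

Lemma subdifferential_monotone u v g h :
  subdifferential f u g -> subdifferential f v h -> 0 <= dot (g - h) (u - v).
Proof.
move=> fu fv; have [r ur] := subdifferential_fin fu.
have [s vs] := subdifferential_fin fv.
have := fu v; have := fv u; rewrite ur vs -!EFinD !lee_fin !dotE.
lra.
Qed.

Lemma le0_of_small_multiples (e D : R) :
  0 <= D -> (forall t, 0 < t -> t < 1 -> e <= t * D) -> e <= 0.
Proof.
move=> D0 eD; rewrite leNgt; apply/negP => e0.
have s0 : 0 < e + D + 1 by lra.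
(* For this [t], [t * D] is smaller than [e]. *)
have := eD (e / (e + D + 1)).
rewrite divr_gt0 // ltr_pdivrMr // mul1r mulrAC ler_pdivlMr // => /(_ isT).
by move=> /(_ ltac:(lra)); nra.
Qed.

(** Fermat's rule for the proximal step. Comparing the minimizer [u] with the
    points [t *: v + (1 - t) *: u] and letting [t] tend to [0] removes the
    second order term of the quadratic. *)
Lemma prox_subgradient (c : R) (a w u : 'cV[R]_p) :
  convex_fun f -> 0 < c ->
  argmin (fun v => f v + (c / 2 * enorm (v - a + c^-1 *: w) ^+ 2)%:E)%E u ->
  subdifferential f u (- (c *: (u - a)) - w).
Proof.
move=> f_convex c0 u_min.
have [r ur] : exists r, f u = r%:E.
  have [v [s fv]] := proper_exists_fin; have := u_min v; rewrite fv.
  move=> uv; have [f_noo _] := f_proper; have := f_noo u; move: uv.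
  by case: (f u) => [r _ _||] //; exists r.
move=> v; have [f_noo _] := f_proper; have := f_noo v.
case fv: (f v) => [s||] // _; last by rewrite leey.
rewrite ur -EFinD lee_fin -subr_le0.
apply: (@le0_of_small_multiples _ (c / 2 * dot (v - u) (v - u))).
  by rewrite mulr_ge0 ?dot_ge0 // divr_ge0 // ltW.
move=> t t0 t1; have := f_convex v u t t0 t1; rewrite fv ur => fc.
have /le_trans := u_min (t *: v + (1 - t) *: u).
move=> /(_ _ (leeD fc (lexx _))); rewrite ur -!EFinM -!EFinD lee_fin !enorm_sqr.
have -> : t *: v + (1 - t) *: u - a + c^-1 *: w
    = (u - a + c^-1 *: w) + t *: (v - u).
  by apply/colP => j; rewrite !mxE; ring.
set z := u - a + c^-1 *: w.
have -> : - (c *: (u - a)) - w = - c *: z.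
  by apply/colP => j; rewrite !mxE; field; rewrite gt_eqF.
move: (v - u) z => h z.
rewrite !dotE (dotC h z) => H.
rewrite -(ler_pM2l t0); nra.
Qed.

(** Lower semicontinuity is what allows [f] itself to be evaluated at the
    limit point. *)
Lemma subdifferential_closed {T : Type} {G : set_system T}
    {GF : ProperFilter G} (u g : T -> 'cV[R]_p) (ul gl : 'cV[R]_p) :
  lower_semicontinuous f ->
  (forall k, subdifferential f (u k) (g k)) ->
  u k @[k --> G] --> ul -> g k @[k --> G] --> gl -> subdifferential f ul gl.
Proof.
move=> f_lsc ug uul ggl v; have [f_noo _] := f_proper; have := f_noo v.
case fv: (f v) => [s||] // _; last by rewrite leey.
rewrite leNgt; apply/negP => sv.
(* A real level strictly between the two sides exists even if [f ul = +oo]. *)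
have [a sa af] : exists2 a : R, s - dot gl (v - ul) < a & (a%:E < f ul)%E.
  have := f_noo ul; move: sv; case: (f ul) => [r||] //.
    rewrite -EFinD lte_fin => sr _.
    by exists ((r + (s - dot gl (v - ul))) / 2); rewrite ?lte_fin //; lra.
  by move=> _ _; exists (s - dot gl (v - ul) + 1); [by lra|exact: ltry].
have [V Vul Va] := f_lsc _ _ af.
have dl : dot (g k) (v - u k) @[k --> G] --> dot gl (v - ul).
  by apply: cvg_dot => //; apply: cvgB => //; exact: cvg_cst.
have sd : s - a < dot gl (v - ul) by lra.
have uV : \forall k \near G, V (u k) := uul _ Vul.
have [k [/Va uk dk]] := filter_ex (filterI uV (cvgr_gt _ dl _ sd)).
have := ug k v; have [r ur] := subdifferential_fin (ug k).
move: uk dk; rewrite fv ur -EFinD lee_fin lte_fin /=; lra.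
Qed.

End Subgradient.

(** * The Lyapunov function *)

Section Energy.
Context {R : realType} {n m : nat} {d : 'I_n -> nat}.
Variables (A : forall i, {linear 'cV[R]_(d i) -> 'cV[R]_m}) (b : 'cV[R]_m).
Variables (eta : 'I_n -> R).
Implicit Types (x y : forall i, 'cV[R]_(d i)) (lam : 'cV[R]_m).

Definition primal_dist2 x y : R :=
  \sum_i eta i * dot (x i - y i) (x i - y i).

Definition energy x lam (bet : R) y mu : R :=
  primal_dist2 x y + bet ^- 2 * dot (lam - mu) (lam - mu).

Hypothesis eta_gt0 : forall i, 0 < eta i.

Lemma primal_dist2_ge_term x y i :
  eta i * dot (x i - y i) (x i - y i) <= primal_dist2 x y.
Proof.
rewrite /primal_dist2 (bigD1 i) //= lerDl; apply: sumr_ge0 => j _.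
by rewrite mulr_ge0 ?dot_ge0 // ltW.
Qed.

Lemma primal_dist2_ge0 x y : 0 <= primal_dist2 x y.
Proof.
by apply: sumr_ge0 => j _; rewrite mulr_ge0 ?dot_ge0 // ltW.
Qed.

Lemma energy_ge0 x lam bet y mu : 0 <= energy x lam bet y mu.
Proof.
by rewrite addr_ge0 ?primal_dist2_ge0 // mulr_ge0 ?dot_ge0 // invr_ge0 sqr_ge0.
Qed.

Lemma energy_le_penalty x lam bet gam y mu :
  0 < bet -> bet <= gam -> energy x lam gam y mu <= energy x lam bet y mu.
Proof.
move=> bet0 betgam; rewrite lerD2l ler_wpM2r ?dot_ge0 //.
have gam0 := lt_le_trans bet0 betgam.
by rewrite lef_pV2 ?posrE ?exprn_gt0 // lerXn2r // nnegrE ltW.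
Qed.

(** The strict inequalities on the [eta i] leave, the index set being finite, a
    uniform margin. *)
Lemma uniform_margin :
  (forall i, n%:R * opnorm (A i) ^+ 2 < eta i) ->
  exists theta : R, [/\ 0 <= theta, theta < 1 &
    forall i, n%:R * opnorm (A i) ^+ 2 <= theta * eta i].
Proof.
move=> eta_gt; pose q i := n%:R * opnorm (A i) ^+ 2 / eta i.
exists (\big[Num.max/0]_i q i); split.
- exact: bigmax_ge_id.
- by apply: bigmax_lt => // i _; rewrite ltr_pdivrMr ?mul1r.
- by move=> i; rewrite -ler_pdivrMr //; exact: le_bigmax.
Qed.

Lemma lin_combB x y : lin_comb A x - lin_comb A y = \sum_i A i (x i - y i).
Proof.
by rewrite /lin_comb -sumrB; apply: eq_bigr => i _; rewrite linearB.
Qed.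

(** The factor [n] is the cost of bounding the square of a sum of [n] vectors
    by the sum of their squares; it is the origin of the [n] in the condition
    on the [eta i]. *)
Lemma lin_combB_le (theta : R) x y :
  (forall i, n%:R * opnorm (A i) ^+ 2 <= theta * eta i) ->
  dot (lin_comb A x - lin_comb A y) (lin_comb A x - lin_comb A y)
    <= theta * primal_dist2 x y.
Proof.
move=> Ath; rewrite lin_combB; apply: le_trans (dot_sum_le _) _.
rewrite card_ord !mulr_sumr; apply: ler_sum => i _; rewrite mulrA.
apply: le_trans (ler_wpM2r (dot_ge0 _) (Ath i)).
by rewrite -mulrA ler_wpM2l ?ler0n // le_opnorm.
Qed.

(** One iteration. The inequality [mono] is the monotonicity of the
    subdifferentials, summed over the blocks; rewritten with the identity
    [2 <p - q, p - z> = |p - z|^2 - |q - z|^2 + |p - q|^2], it becomes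
    the decrease of the energy up to the cross term
    [2 <r', lin_comb A x' - lin_comb A x>], where [r'] is the new residual. The
    Jacobi (parallel) update produces this term, and the margin [theta] absorbs
    it by Young's inequality with weight [(1 + theta) / 2]. *)
Lemma energy_decrease (theta bet : R) x x' lam y mu :
  0 < bet -> 0 <= theta -> theta < 1 ->
  (forall i, n%:R * opnorm (A i) ^+ 2 <= theta * eta i) ->
  lin_comb A y = b ->
  (forall i, 0 <= dot
     (- ((eta i * bet) *: (x' i - x i)) - adjoint (A i) (lam_hat A b bet x lam)
      - - adjoint (A i) mu) (x' i - y i)) ->
  energy x' (lam + bet *: (lin_comb A x' - b)) bet y mu
    + (1 - theta) / 2 * (primal_dist2 x' x
        + dot (lin_comb A x' - b) (lin_comb A x' - b))
    <= energy x lam bet y mu.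
Proof.
move=> bet0 th0 th1 Ath Ay mono.
set r' := lin_comb A x' - b; set r := lin_comb A x - b.
pose q := r' - r; pose l := lam - mu.
have qE : q = lin_comb A x' - lin_comb A x.
  by rewrite /q /r' /r opprB addrA subrK.
have q_le : dot q q <= theta * primal_dist2 x' x.
  by rewrite qE; exact: lin_combB_le.
have mono_sum : bet * (primal_dist2 x' y - primal_dist2 x y + primal_dist2 x' x)
    + 2 * dot r' (l + bet *: r) <= 0.
  have -> : dot r' (l + bet *: r)
      = \sum_i dot (A i (x' i - y i)) (l + bet *: r).
    by rewrite -dot_suml -lin_combB Ay.
  rewrite /primal_dist2 -sumrB -big_split !mulr_sumr -big_split /=.
  apply: sumr_le0 => i _; have := mono i.
  rewrite opprK !(dotDl, dotNl, dotZl) !(dotC (adjoint _ _)) -!adjointP.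
  rewrite /lam_hat -/r /l !(dotDl, dotNl, dotDr, dotNr, dotZl, dotZr).
  rewrite (dotC (x i) (x' i)) (dotC (y i) (x' i)) (dotC (y i) (x i)).
  lra.
have rE : r = r' - q by rewrite /q opprB addrC subrK.
rewrite /energy.
have -> : lam + bet *: r' - mu = l + bet *: r' by rewrite /l addrAC.
rewrite -/l; clearbody l q r r'.
have dual : bet ^- 2 * (dot (l + bet *: r') (l + bet *: r') - dot l l)
    = bet^-1 * (2 * dot r' l) + dot r' r'.
  by rewrite !dotE (dotC l r'); field; rewrite gt_eqF.
have {mono_sum} decr : primal_dist2 x' y - primal_dist2 x y
    + primal_dist2 x' x + bet^-1 * (2 * dot r' l) + 2 * dot r' r'
    - 2 * dot r' q <= 0.
  rewrite -(pmulr_rle0 _ bet0); apply: le_trans mono_sum.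
  rewrite {1}rE !dotE le_eqVlt; apply/orP; left; apply/eqP.
  by field; rewrite gt_eqF.
(* With [s = (1 + theta) / 2], [theta <= s ^+ 2] and [1 - s] is the constant
   [(1 - theta) / 2] of the statement. *)
have young : 2 * dot r' q
    <= (1 + theta) / 2 * (primal_dist2 x' x + dot r' r').
  have := dot_ge0 (((1 + theta) / 2) *: r' - q).
  rewrite !dotE (dotC q r') => sq.
  have P0 := primal_dist2_ge0 x' x.
  have s0 : 0 < (1 + theta) / 2 by lra.
  have th_s : theta <= ((1 + theta) / 2) ^+ 2.
    by have := sqr_ge0 (1 - theta); rewrite !expr2; lra.
  rewrite -(ler_pM2l s0); move: (ler_wpM2r P0 th_s) sq q_le; rewrite !expr2.
  move: ((1 + theta) / 2) => s.
  lra.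
move: dual; rewrite mulrBr; lra.
Qed.

End Energy.

(** The decrements of a convergent sequence tend to [0]. *)
Lemma summable_decrease_cvg0 {R : realType} (W e : nat -> R) (c : R) :
  0 < c -> (forall k, 0 <= W k) -> (forall k, 0 <= e k) ->
  (forall k, W k.+1 + c * e k <= W k) -> e k @[k --> \oo] --> (0 : R).
Proof.
move=> c0 W0 e0 We.
have Wcvg : W k @[k --> \oo] --> inf (range W).
  apply: nonincreasing_cvgn; last by exists 0 => _ [k _ <-].
  apply/nonincreasing_seqP => k; apply: le_trans (We k).
  by rewrite lerDl mulr_ge0 // ltW.
have dW : c^-1 * (W k - W k.+1) @[k --> \oo] --> (0 : R).
  rewrite -(mulr0 c^-1) -(subrr (inf (range W))); apply: cvgMr.
  by apply: cvgB => //; rewrite (cvg_shiftS W).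
apply: squeeze_cvgr (cvg_cst 0) dW; apply: nearW => k.
by rewrite e0 /= ler_pdivlMl // lerBrDl We.
Qed.

(** The filter only has to exhibit arbitrarily small terms, and each term bounds
    all the later ones. *)
Lemma nonincreasing_cvg0_of_filter {R : realType} (W : nat -> R)
    (G : set_system nat) {GF : ProperFilter G} :
  (forall k, 0 <= W k) -> (forall k, W k.+1 <= W k) ->
  W k @[k --> G] --> (0 : R) -> W k @[k --> \oo] --> (0 : R).
Proof.
move=> W0 /nonincreasing_seqP Wdecr WG; apply/cvgrPdist_lt => e e0.
have [N /= WN] := filter_ex (cvgr_lt _ WG _ e0).
exists N => // k /= Nk; rewrite sub0r normrN ger0_norm //.
exact: le_lt_trans (Wdecr _ _ Nk) WN.
Qed.
(** * Runs of the algorithm *)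

Section Run.
Context {R : realType} {n m : nat} {d : 'I_n -> nat}.
Variables (f : forall i, 'cV[R]_(d i) -> \bar R).
Arguments f : clear implicits.
Variables (A : forall i, {linear 'cV[R]_(d i) -> 'cV[R]_m}) (b : 'cV[R]_m).
Variables (eta : 'I_n -> R) (beta : nat -> R).
Variables (x : nat -> forall i, 'cV[R]_(d i)) (lam : nat -> 'cV[R]_m).
Hypothesis f_cpc : forall i, closed_proper_convex (f i).
Hypothesis eta_gt0 : forall i, 0 < eta i.
Hypothesis beta_gt0 : forall k, 0 < beta k.
Hypothesis beta_mono : forall k l : nat, (k <= l)%N -> beta k <= beta l.
Variable M : R.
Hypothesis beta_le : forall k, beta k <= M.
Variable theta : R.
Hypothesis theta_ge0 : 0 <= theta.
Hypothesis theta_lt1 : theta < 1.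
Hypothesis margin : forall i, n%:R * opnorm (A i) ^+ 2 <= theta * eta i.
Hypothesis run : LADMPSAP f A b eta beta x lam.

Let f_proper i : proper_fun (f i).
Proof. by case: (f_cpc i). Qed.

Let f_convex i : convex_fun (f i).
Proof. by case: (f_cpc i). Qed.

Let f_lsc i : lower_semicontinuous (f i).
Proof. by case: (f_cpc i). Qed.

Let residual k := lin_comb A (x k) - b.

Let run_subgradient k i : 'cV[R]_(d i) :=
  - ((eta i * beta k) *: (x k.+1 i - x k i))
  - adjoint (A i) (lam_hat A b (beta k) (x k) (lam k)).

Let run_subgradientP k i :
  subdifferential (f i) (x k.+1 i) (run_subgradient k i).
Proof.
apply: prox_subgradient => //; first by rewrite mulr_gt0.
by have [/(_ i)] := run k.
Qed.

Let progress k :=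
  primal_dist2 eta (x k.+1) (x k) + dot (residual k.+1) (residual k.+1).

Let progress_ge0 k : 0 <= progress k.
Proof. by rewrite addr_ge0 ?primal_dist2_ge0 // dot_ge0. Qed.

Let energy_along ys mu k := energy eta (x k) (lam k) (beta k) ys mu.

(** The growth of the penalty only lowers the weight of the dual term, so the
    decrease of one iteration chains with the next one. *)
Lemma energy_along_decrease ys mu k : KKT_point f A b ys mu ->
  energy_along ys mu k.+1 + (1 - theta) / 2 * progress k
    <= energy_along ys mu k.
Proof.
move=> [Ay ymu]; have [_ lamE] := run k.
have mono i : 0 <= dot (run_subgradient k i - - adjoint (A i) mu)
    (x k.+1 i - ys i).
  by have := subdifferential_monotone (f_proper i)
    (@run_subgradientP k i) (ymu i).
have := energy_decrease eta_gt0 (beta_gt0 k) theta_ge0 theta_lt1 margin Ay mono.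
apply: le_trans.
by rewrite -lamE lerD2r energy_le_penalty // beta_mono.
Qed.

Lemma energy_along_nonincreasing ys mu k : KKT_point f A b ys mu ->
  energy_along ys mu k.+1 <= energy_along ys mu k.
Proof.
move=> kkt; apply: le_trans (energy_along_decrease k kkt).
by rewrite lerDl mulr_ge0 // divr_ge0 // subr_ge0 ltW.
Qed.

Lemma penalty_cvg : exists l : R, beta k @[k --> \oo] --> l.
Proof.
apply/cvg_ex; apply: nondecreasing_is_cvgn => //.
by exists M => _ [k _ <-].
Qed.

Section WithKKT.
Variables (ys : forall i, 'cV[R]_(d i)) (mu : 'cV[R]_m).
Hypothesis kkt : KKT_point f A b ys mu.

Lemma progress_cvg0 : progress k @[k --> \oo] --> (0 : R).
Proof.
apply: (@summable_decrease_cvg0 _ (energy_along ys mu) _ ((1 - theta) / 2)).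
- by rewrite divr_gt0 // subr_gt0.
- by move=> k; exact: energy_ge0.
- exact: progress_ge0.
- by move=> k; exact: energy_along_decrease.
Qed.

Lemma step_cvg0 i :
  x k.+1 i - x k i @[k --> \oo] --> (0 : 'cV[R]_(d i)).
Proof.
apply: cvg_of_dot; under eq_fun do rewrite subr0.
have pr : (eta i)^-1 * progress k @[k --> \oo] --> (0 : R).
  by rewrite -(mulr0 (eta i)^-1); apply: cvgMr; exact: progress_cvg0.
apply: squeeze_cvgr (cvg_cst 0) pr; apply: nearW => k.
rewrite dot_ge0 /= ler_pdivlMl //.
apply: le_trans (primal_dist2_ge_term eta_gt0 _ _ i) _.
by rewrite lerDl dot_ge0.
Qed.

Lemma residual_cvg0 : residual k @[k --> \oo] --> (0 : 'cV[R]_m).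
Proof.
rewrite -(cvg_shiftS residual).
apply: cvg_of_dot; under eq_fun do rewrite subr0.
apply: squeeze_cvgr (cvg_cst 0) progress_cvg0; apply: nearW => k.
by rewrite dot_ge0 lerDr primal_dist2_ge0.
Qed.

Lemma scaled_residual_cvg0 :
  beta k *: residual k @[k --> \oo] --> (0 : 'cV[R]_m).
Proof.
have [l bl] := penalty_cvg.
by rewrite -(scaler0 _ l); apply: cvgZ bl residual_cvg0.
Qed.

Lemma energy_along_le k : energy_along ys mu k <= energy_along ys mu 0.
Proof.
elim: k => // k; apply: le_trans; exact: energy_along_nonincreasing.
Qed.

Lemma primal_bounded k i :
  dot (x k i - ys i) (x k i - ys i) <= (eta i)^-1 * energy_along ys mu 0.
Proof.
rewrite ler_pdivlMl //; apply: le_trans (energy_along_le k).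
apply: le_trans (primal_dist2_ge_term eta_gt0 _ _ i) _.
by rewrite lerDl mulr_ge0 ?dot_ge0 // invr_ge0 sqr_ge0.
Qed.

(** The upper bound on the penalties keeps the weight of the dual term away
    from [0]. *)
Lemma dual_bounded k :
  dot (lam k - mu) (lam k - mu) <= M ^+ 2 * energy_along ys mu 0.
Proof.
have M0 := lt_le_trans (beta_gt0 0) (beta_le 0).
rewrite -ler_pdivrMl ?exprn_gt0 //; apply: le_trans (energy_along_le k).
apply: le_trans (energy_le_penalty _ _ _ _ _ (beta_gt0 k) (beta_le k)).
by rewrite lerDr primal_dist2_ge0.
Qed.

End WithKKT.

(** Along a filter finer than the neighbourhoods of infinity, any limit is a KKT
    point: the optimality conditions of the subproblems hold with errors that
    vanish with the steps and the residual. *)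
Lemma limit_KKT (G : set_system nat) {GF : ProperFilter G} ys mu
    (xl : forall i, 'cV[R]_(d i)) (laml : 'cV[R]_m) :
  \oo `<=` G -> KKT_point f A b ys mu ->
  (forall i, x k i @[k --> G] --> xl i) -> lam k @[k --> G] --> laml ->
  KKT_point f A b xl laml.
Proof.
move=> ooG kkt xxl lamlaml.
(* Limits along the integers persist along [G]. *)
have toG (V : topologicalType) (h : nat -> V) (l : V) :
    h k @[k --> \oo] --> l -> h k @[k --> G] --> l.
  by move=> hl N /hl; exact: ooG.
have resG : residual k @[k --> G] --> lin_comb A xl - b.
  apply: cvgB; last exact: cvg_cst.
  apply: cvg_big => [|i _]; first exact: add_continuous.
  exact: cvg_linear.
split.
  apply/eqP; rewrite -subr_eq0; apply/eqP.
  exact: (cvg_unique _ resG (toG _ _ _ (residual_cvg0 kkt))).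
move=> i.
have stepG := toG _ _ _ (step_cvg0 kkt (i := i)).
apply: (@subdifferential_closed _ _ _ (f_proper i) _ G _
  (fun k => x k.+1 i) (fun k => run_subgradient k i)) => //.
  have : x k i + (x k.+1 i - x k i) @[k --> G] --> xl i + 0.
    exact: cvgD (xxl i) stepG.
  rewrite addr0.
  by under eq_fun do rewrite addrC subrK.
rewrite -[X in _ --> X]sub0r; apply: cvgB.
  have [l bl] := penalty_cvg.
  rewrite -oppr0 -(scaler0 _ (eta i * l)); apply: cvgN; apply: cvgZ stepG.
  by apply: cvgMr; exact: toG.
apply: cvg_adjoint; rewrite -[laml]addr0; apply: cvgD => //.
exact: toG (scaled_residual_cvg0 kkt).
Qed.

Lemma energy_along_cvg0 (G : set_system nat) {GF : ProperFilter G}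
    (xl : forall i, 'cV[R]_(d i)) (laml : 'cV[R]_m) :
  (forall i, x k i @[k --> G] --> xl i) -> lam k @[k --> G] --> laml ->
  energy_along xl laml k @[k --> G] --> (0 : R).
Proof.
move=> xxl lamlaml.
(* The energy is largest with the smallest penalty, [beta 0], and then its
   coefficients are fixed. *)
pose E0 k := primal_dist2 eta (x k) xl
  + beta 0 ^- 2 * dot (lam k - laml) (lam k - laml).
have dot0 p (u : nat -> 'cV[R]_p) (l : 'cV[R]_p) : u k @[k --> G] --> l ->
    dot (u k - l) (u k - l) @[k --> G] --> (0 : R).
  move=> ul; rewrite -(dot0l (0 : 'cV[R]_p)) -(subrr l).
  by apply: cvg_dot; apply: cvgB => //; exact: cvg_cst.
have E0cvg : E0 k @[k --> G] --> (0 : R).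
  rewrite -[X in _ --> X]addr0; apply: cvgD.
    rewrite [X in _ --> X](_ : 0 = \sum_(i < n) eta i * 0); last first.
      by rewrite -mulr_suml mulr0.
    apply: cvg_big => [|i _]; first exact: add_continuous.
    by apply: cvgMr; exact: dot0.
  by rewrite -(mulr0 (beta 0 ^- 2)); apply: cvgMr; exact: dot0.
apply: squeeze_cvgr (cvg_cst 0) E0cvg; apply: nearW => k.
by rewrite energy_ge0 //=; apply: energy_le_penalty => //; exact: beta_mono.
Qed.

(** The energy relative to the limit point controls the distance to it. *)
Lemma cvg_of_energy (xl : forall i, 'cV[R]_(d i)) (laml : 'cV[R]_m) :
  energy_along xl laml k @[k --> \oo] --> (0 : R) ->
  (forall i, x k i @[k --> \oo] --> xl i) /\ lam k @[k --> \oo] --> laml.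
Proof.
move=> W0; split=> [i|]; apply: cvg_of_dot.
  have W1 : (eta i)^-1 * energy_along xl laml k @[k --> \oo] --> (0 : R).
    by rewrite -(mulr0 (eta i)^-1); apply: cvgMr.
  apply: squeeze_cvgr (cvg_cst 0) W1; apply: nearW => k.
  rewrite dot_ge0 /= ler_pdivlMl //.
  apply: le_trans (primal_dist2_ge_term eta_gt0 _ _ i) _.
  by rewrite lerDl mulr_ge0 ?dot_ge0 // invr_ge0 sqr_ge0.
have W1 : M ^+ 2 * energy_along xl laml k @[k --> \oo] --> (0 : R).
  by rewrite -(mulr0 (M ^+ 2)); apply: cvgMr.
apply: squeeze_cvgr (cvg_cst 0) W1; apply: nearW => k.
have M0 := lt_le_trans (beta_gt0 0) (beta_le 0).
rewrite dot_ge0 /= -ler_pdivrMl ?exprn_gt0 //.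
apply: le_trans (energy_le_penalty _ _ _ _ _ (beta_gt0 k) (beta_le k)).
by rewrite lerDr primal_dist2_ge0.
Qed.

(** The energy is first taken relative to some KKT point, for boundedness, and
    then relative to the limit that this provides. *)
Lemma run_cvg ys mu : KKT_point f A b ys mu ->
  exists (xs : forall i, 'cV[R]_(d i)) (ls : 'cV[R]_m), [/\ KKT_point f A b xs ls,
    forall i, x k i @[k --> \oo] --> xs i & lam k @[k --> \oo] --> ls].
Proof.
move=> kkt; have [G [GU ooG]] := ultraFilterLemma (@eventually_filter).
have xG i := bounded_ultra_cvg (GU := GU) (fun k => primal_bounded kkt k i).
have [ls lsG] := bounded_ultra_cvg (GU := GU) (dual_bounded kkt).
pose xs i := projT1 (cid (xG i)).
have xsG i : x k i @[k --> G] --> xs i by rewrite /xs; case: cid.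
have GF : ProperFilter G by exact: ultra_proper.
have skkt : KKT_point f A b xs ls by exact: limit_KKT ooG kkt xsG lsG.
have W0 : energy_along xs ls k @[k --> \oo] --> (0 : R).
  apply: (nonincreasing_cvg0_of_filter (G := G)).
  - by move=> k; exact: energy_ge0.
  - by move=> k; exact: energy_along_nonincreasing skkt.
  - exact: energy_along_cvg0 xsG lsG.
by exists xs, ls; have [] := cvg_of_energy W0; split.
Qed.

End Run.

Unset Implicit Arguments.

Theorem theorem1 (R : realType) (n m : nat) (d : 'I_n -> nat)
    (f : forall i : 'I_n, 'cV[R]_(d i) -> \bar R)
    (A : forall i : 'I_n, {linear 'cV[R]_(d i) -> 'cV[R]_m})
    (b : 'cV[R]_m)
    (eta : 'I_n -> R) (beta : nat -> R)
    (x : nat -> forall i : 'I_n, 'cV[R]_(d i)) (lam : nat -> 'cV[R]_m)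
    (f_cpc : forall i, closed_proper_convex (f i))
    (A_neq0 : forall i, exists u : 'cV[R]_(d i), A i u <> 0)
    (sol_nonunique : exists u v : forall i : 'I_n, 'cV[R]_(d i),
       [/\ lin_comb A u = b, lin_comb A v = b & u <> v])
    (A_onto : forall w : 'cV[R]_m,
       exists u : forall i : 'I_n, 'cV[R]_(d i), lin_comb A u = w)
    (KKT_ex : exists (xs : forall i : 'I_n, 'cV[R]_(d i)) (ls : 'cV[R]_m),
       KKT_point f A b xs ls)
    (eta_gt0 : forall i, 0 < eta i)
    (beta_gt0 : forall k, 0 < beta k)
    (beta_nondecreasing : forall k l : nat, (k <= l)%N -> beta k <= beta l)
    (beta_bounded : exists M : R, forall k, beta k <= M)
    (eta_gt : forall i, n%:R * opnorm (A i) ^+ 2 < eta i)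
    (x_lam_run : LADMPSAP f A b eta beta x lam) :
  exists (xs : forall i : 'I_n, 'cV[R]_(d i)) (ls : 'cV[R]_m),
    [/\ KKT_point f A b xs ls,
        forall i, x k i @[k --> \oo] --> xs i
      & lam k @[k --> \oo] --> ls].
Proof.
have [ys [mu kkt]] := KKT_ex; have [M beta_le] := beta_bounded.
have [theta [theta_ge0 theta_lt1 margin]] := uniform_margin eta_gt0 eta_gt.
exact: (run_cvg f_cpc eta_gt0 beta_gt0 beta_nondecreasing beta_le
  theta_ge0 theta_lt1 margin x_lam_run kkt).
Qed.
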